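(* Let $\mathbf X=(x_1,\dots,x_n)$ be an $n$-tuple of observations on $M$. Then, for any $c\in[0,\infty)$, $$\epsilon^*(m_n^c,\mathbf X)\ \ge\ \Big\lfloor\frac{n+1}{2}\Big\rfloor\Big/n,$$ where $m_n^c$ is the sample Huber mean for $c$ (defined by the Huber loss $\rho_c$), assumed unique.
   Context: $M$ is a smooth Riemannian manifold without boundary, geodesically complete, connected and separable, with Riemannian distance $d$; its sectional curvatures have least upper bound $\Delta<\infty$ and greatest lower bound $\delta>-\infty$. Huber loss: for $c\in(0,\infty)$ and $x\ge 0$, $\rho_c(x)=x^2$ if $x\le c$ and $\rho_c(x)=2c(x-\tfrac c2)$ if $x>c$; $\rho_0(x)=x$. The sample Huber mean $m_n^c(\mathbf Y)$ of $\mathbf Y=(y_1,\dots,y_n)\in M^n$ is the minimizer over $m\in M$ of $\frac1n\sum_{i=1}^n\rho_c\{d(y_i,m)\}$. Standing assumption: the sample Huber mean is unique wherever it is evaluated; thus $\mathbf X$ has a unique sample Huber mean, and the corrupted tuples below are those having a unique sample Huber mean. For $1\le k\le n$, $\mathbf Y_k\in M^n$ denotes a corruption of $\mathbf X$: a tuple consisting of $k$ arbitrary points of $M$ and $n-k$ points from $\mathbf X$ (i.e. $k$ entries of $\mathbf X$ are replaced by arbitrary points). The breakdown point of $m_n^c$ at $\mathbf X$ is $$\epsilon^*(m_n^c,\mathbf X)=\min_{1\le k\le n}\Big\{\tfrac kn:\ \sup_{\mathbf Y_k}d(m_n^c(\mathbf X),m_n^c(\mathbf Y_k))=\infty\Big\},$$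 the supremum being over all possible $\mathbf Y_k$; if no such $k$ exists (e.g. $M$ bounded), $\epsilon^*=1$ by convention. *)

(* Defs.v *)
(* MathComp-Analysis, over an arbitrary [R : realType]. *)
From HB Require Import structures.
From mathcomp Require Export all_boot all_order all_algebra.
From mathcomp Require Export all_classical all_reals all_analysis.
Export numFieldNormedType.Exports.
Export Order.TTheory GRing.Theory Num.Theory.

Set Implicit Arguments.
Unset Strict Implicit.
Unset Printing Implicit Defensive.

Local Open Scope classical_set_scope.
Local Open Scope ring_scope.

Section Smoothness.
Context {R : realType} {V W : normedModType R}.

(* [U] is open in all uses.  For finite-dimensional [V], the C^k regularity of
   x |-> 'd f x is that of x |-> 'd f x v for every fixed v. *)
Fixpoint Ck_on (k : nat) (U : set V) (f : V -> W) : Prop :=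
  if k is k'.+1 then
    (forall x, U x -> differentiable f x) /\
    (forall v : V, Ck_on k' U (fun x => 'd f x v))
  else forall x, U x -> {for x, continuous f}.

Definition smooth_on (U : set V) (f : V -> W) : Prop := forall k, Ck_on k U f.

End Smoothness.

(* [param] is only relevant on [coord @` dom]. *)
Record chart (R : realType) (dim : nat) (M : topologicalType) := Chart {
  dom : set M ;
  coord : M -> 'rV[R]_dim ;
  param : 'rV[R]_dim -> M ;
  dom_open : open dom ;
  image_open : open (coord @` dom) ;
  coordK : forall x, dom x -> param (coord x) = x ;
  coord_continuous : forall x, dom x -> {for x, continuous coord} ;
  param_continuous :
    forall y, (coord @` dom) y -> {for y, continuous param}
}.

(* [atlas] need not be maximal.  [chart_at x] is a preferred chart around x; it
   is used to represent T_x M as 'rV[R]_dim, and the notions below do not depend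
   on it. *)
Record smooth_atlas (R : realType) (dim : nat) (M : topologicalType) :=
  SmoothAtlas {
  atlas : set (chart R dim M) ;
  chart_at : M -> chart R dim M ;
  chart_at_atlas : forall x, atlas (chart_at x) ;
  chart_at_dom : forall x, dom (chart_at x) x ;
  transition_smooth : forall phi psi, atlas phi -> atlas psi ->
    smooth_on (coord phi @` (dom phi `&` dom psi)) (coord psi \o param phi)
}.

(* [gram phi y] is the matrix (g_ij) at the point of coordinates y in phi. *)
Record riemannian_metric (R : realType) (dim : nat) (M : topologicalType)
    (A : smooth_atlas R dim M) := RiemannianMetric {
  gram : chart R dim M -> 'rV[R]_dim -> 'M[R]_dim ;
  gram_smooth : forall phi (i j : 'I_dim), atlas A phi ->
    smooth_on (coord phi @` dom phi) (fun y => gram phi y i j : R^o) ;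
  gram_sym : forall phi y, atlas A phi -> (coord phi @` dom phi) y ->
    (gram phi y)^T = gram phi y ;
  gram_pos : forall phi y (v : 'rV[R]_dim),
    atlas A phi -> (coord phi @` dom phi) y -> v != 0 ->
    0 < (v *m gram phi y *m v^T) 0 0 ;
  gram_transition : forall phi psi x (u v : 'rV[R]_dim),
    atlas A phi -> atlas A psi -> dom phi x -> dom psi x ->
    let dtau := 'd (coord psi \o param phi) (coord phi x) in
    dtau u *m gram psi (coord psi x) *m (dtau v)^T =
      u *m gram phi (coord phi x) *m v^T
}.

Section RiemannianGeometry.
Context {R : realType} {dim : nat} {M : topologicalType}
  {A : smooth_atlas R dim M} (g : riemannian_metric A).
Implicit Types (phi : chart R dim M) (gamma : R -> M) (y u v : 'rV[R]_dim).

Definition smooth_curve_on (I : set R) gamma : Prop :=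
  (forall t, I t -> {for t, continuous gamma}) /\
  (forall phi, atlas A phi ->
    smooth_on ((I `&` gamma @^-1` dom phi) : set R^o)
              (coord phi \o gamma : R^o -> 'rV[R]_dim)).

(* smooth up to the end points, i.e. extends to an open interval *)
Definition smooth_segment gamma : Prop :=
  exists2 e : R, 0 < e & smooth_curve_on `]- e, 1 + e[ gamma.

Definition inner phi (x : M) u v : R :=
  (u *m gram g phi (coord phi x) *m v^T) 0 0.

Definition velocity phi gamma (t : R) : 'rV[R]_dim := derive1 (coord phi \o gamma) t.

Definition speed gamma (t : R) : R :=
  let phi := chart_at A (gamma t) in
  Num.sqrt (inner phi (gamma t) (velocity phi gamma t) (velocity phi gamma t)).

Definition curve_length gamma : \bar R :=
  (\int[lebesgue_measure]_(t in `[0%R, 1%R]) (speed gamma t)%:E)%E.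

(* [joined x y L]: a piecewise smooth curve of length L goes from x to y.  Such
   a curve is given by its successive smooth pieces, each one affinely
   reparametrized to [0, 1]. *)
Inductive joined : M -> M -> \bar R -> Prop :=
| joined_refl x : joined x x 0%E
| joined_cons gamma (z : M) L : smooth_segment gamma -> joined (gamma 1) z L ->
    joined (gamma 0) z (curve_length gamma + L)%E.

(* On a connected manifold the infimum is finite. *)
Definition rdist (x y : M) : R := fine (ereal_inf [set L | joined x y L]).

Definition partial (i : 'I_dim) (f : 'rV[R]_dim -> R) y : R :=
  'D_(delta_mx 0 i) (f : 'rV[R]_dim -> R^o) y.

(* Gamma^k_ij *)
Definition christoffel phi (k i j : 'I_dim) y : R :=
  2^-1 * \sum_(l < dim) invmx (gram g phi y) k l *
    (partial i (fun z => gram g phi z j l) y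
     + partial j (fun z => gram g phi z i l) y
     - partial l (fun z => gram g phi z i j) y).

Definition geodesic gamma : Prop :=
  smooth_curve_on setT gamma /\
  forall phi t (k : 'I_dim), atlas A phi -> dom phi (gamma t) ->
    let c := coord phi \o gamma in
    (derive1n 2 c t) 0 k +
      \sum_(i < dim) \sum_(j < dim)
        christoffel phi k i j (c t) * (derive1 c t) 0 i * (derive1 c t) 0 j = 0.

Definition geodesically_complete : Prop :=
  forall p v, exists gamma,
    [/\ geodesic gamma, gamma 0 = p & velocity (chart_at A p) gamma 0 = v].

(* Riem(d_i, d_j) d_k = \sum_l riemann l i j k d_l, where
   Riem(X, Y) Z = D_X D_Y Z - D_Y D_X Z - D_[X, Y] Z *)
Definition riemann phi (l i j k : 'I_dim) y : R :=
  partial i (christoffel phi l j k) y - partial j (christoffel phi l i k) y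
  + \sum_(h < dim) (christoffel phi h j k y * christoffel phi l i h y
                    - christoffel phi h i k y * christoffel phi l j h y).

Definition riemann_vec phi y u v (w : 'rV[R]_dim) : 'rV[R]_dim :=
  \row_(l < dim) \sum_(i < dim) \sum_(j < dim) \sum_(k < dim)
    riemann phi l i j k y * u 0 i * v 0 j * w 0 k.

Definition sectional_curvature (p : M) u v : R :=
  let phi := chart_at A p in
  inner phi p (riemann_vec phi (coord phi p) u v v) u /
    (inner phi p u u * inner phi p v v - inner phi p u v ^+ 2).

(* Empty when dim < 2. *)
Definition sectional_curvatures : set (\bar R) :=
  [set K | exists p u v, row_free (col_mx u v) /\
                         K = (sectional_curvature p u v)%:E].

End RiemannianGeometry.

Definition separable (T : topologicalType) : Prop :=
  exists2 D : set T, countable D & dense D.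

Definition huber_loss {R : realType} (c x : R) : R :=
  if c == 0 then x
  else if x <= c then x ^+ 2 else 2 * c * (x - c / 2).

Section HuberMean.
Context {R : realType} {dim : nat} {M : topologicalType}
  {A : smooth_atlas R dim M} (g : riemannian_metric A).
Context {n : nat}.
Implicit Types (X Y : 'I_n -> M) (c : R).

Definition huber_risk c Y (m : M) : R :=
  n%:R^-1 * \sum_(i < n) huber_loss c (rdist g (Y i) m).

Definition minimizes_huber_risk c Y (m : M) : Prop :=
  forall m', huber_risk c Y m <= huber_risk c Y m'.

(* [m] is the unique sample Huber mean of [Y]. *)
Definition is_huber_mean c Y (m : M) : Prop :=
  minimizes_huber_risk c Y m /\
  forall m', minimizes_huber_risk c Y m' -> m' = m.

Definition corruption (k : nat) X Y : Prop :=
  exists2 S : {set 'I_n}, #|S| = k & forall i, i \notin S -> Y i = X i.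

Definition breaks_down c X (k : nat) : Prop :=
  ereal_sup [set r : \bar R | exists m Y mY,
    [/\ is_huber_mean c X m, corruption k X Y, is_huber_mean c Y mY &
        r = (rdist g m mY)%:E]] = +oo%E.

(* As k / n <= 1, the neutral value 1 only matters if no k breaks down. *)
Definition breakdown_point c X : R :=
  \big[Num.min/1]_(1 <= k < n.+1 | `[< breaks_down c X k >]) (k%:R / n%:R).

End HuberMean.

(* Main.v *)
Require Import Defs.
From mathcomp Require Import unstable measurable_realfun ring lra zify.

(** The Huber loss is squeezed between affine functions of the same slope [s] and
    is [s]-Lipschitz, so each corrupted observation pulls the mean with a force at
    most [s], while an uncorrupted observation pulls it back with a force that is
    asymptotically [s]. When fewer than half of the observations are corrupted the
    uncorrupted ones win: comparing the risk of the corrupted sample at its own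
    mean [mY] and at the original mean [m] bounds the distance from [m] to [mY] by
    a constant depending only on the original sample ([corrupted_mean_bound]).
    Hence breakdown requires [n <= 2 * k], that is [k >= (n + 1) %/ 2].

    The only geometry in this argument is that the Riemannian distance is
    nonnegative, symmetric and satisfies the triangle inequality, which is derived
    from its definition as an infimum of lengths. The triangle inequality
    comes from concatenation of piecewise smooth curves ([joined_trans]). Symmetry
    comes from reversal ([joined_sym]), which preserves smoothness because
    t |-> 1 - t is affine ([Ck_on_line]) and length because Lebesgue measure is
    invariant under that reflection ([ge0_integral_onem01]).

    The distance is moreover defined as the real part of an extended real infimum,
    so the triangle inequality holds only because any two points are joined by a
    curve of finite length. Nearby points are joined by straight segments in a
    chart, whose speed is continuous and therefore integrable
    ([coordinate_segment_length]); connectedness of the manifold makes this global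
    ([connected_rectifiably_joined]). *)

Set Implicit Arguments.
Unset Strict Implicit.
Unset Printing Implicit Defensive.
Local Open Scope classical_set_scope.
Local Open Scope ring_scope.

(** * Smooth functions along affine lines *)

Section Calculus.
Context {R : realType} {V W : normedModType R}.

(** The differential is defined by choice, so its dependence on the germ alone goes
    through the uniqueness of the first-order expansion. *)
Lemma near_eq_is_diff (f h : V -> W) x :
  (\near x, f x = h x) -> differentiable f x ->
  is_diff x h ('d f x).
Proof.
move=> fh df.
have fhx : f x = h x by exact: nbhs_singleton fh.
have key : h \o shift x = cst (h x) + 'd f x +o_ 0 id.
  apply/eqaddoP => e e0.
  have := diff_locally df => /eqaddoP /(_ e e0) dfe.
  have fh0 : \forall z \near (0 : V), f (z + x) = h (z + x).
    by move: fh; rewrite (near_shift 0 x) subr0.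
  near=> z.
  have <- : (f \o shift x - (cst (f x) + 'd f x)) z =
     (h \o shift x - (cst (h x) + 'd f x)) z.
    rewrite !fctE /= fhx; congr (_ - _); near: z; exact: fh0.
  by near: z.
have dE : 'd h x = 'd f x :> (V -> W).
  by apply: diff_unique key; exact: diff_continuous.
split => //; apply/diff_locallyP; rewrite dE; split => //.
exact: diff_continuous.
Unshelve. all: by end_near. Qed.

(** The set has to be open because the differentials in [Ck_on] are taken in the
    whole space, not within the set. *)
Lemma Ck_on_congr k (U : set V) (f h : V -> W) : open U ->
  (forall x, U x -> f x = h x) -> Ck_on k U f -> Ck_on k U h.
Proof.
move=> oU; elim: k f h => [|k IH] f h fh /=.
  move=> cf x Ux; have fhx : \near x, f x = h x.
    by apply: filterS (open_nbhs_nbhs (conj oU Ux)) => z; exact: fh.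
  suff : h @ x --> h x by []; rewrite -(fh _ Ux); apply: cvg_trans (cf x Ux).
  exact: near_eq_cvg.
move=> [df dCk].
have dh x : U x -> is_diff x h ('d f x).
  move=> Ux; apply: near_eq_is_diff (df x Ux).
  by apply: filterS (open_nbhs_nbhs (conj oU Ux)) => z; exact: fh.
split => [x /dh [] //|v].
by apply: IH (dCk v) => x /dh [_ ->].
Qed.

End Calculus.

Section Lines.
Context {R : realType} {V W : normedModType R}.

Lemma is_diff_line (f : V -> W) (a w : V) (t : R) :
  differentiable f (a + t *: w) ->
  is_diff (t : R^o) (fun s : R^o => f (a + s *: w))
          (fun h => 'd f (a + t *: w) (h *: w)).
Proof.
move=> df.
have dl : is_diff (t : R^o) (fun s : R^o => a + s *: w) (fun h => h *: w).
  have := is_diffD (is_diff_cst a (t : R^o)) (is_diff_scalel t w).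
  by rewrite add0r.
apply: (@is_diff_comp _ _ _ _ (fun s : R^o => a + s *: w) (fun h => h *: w) f ('d f (a + t *: w))).
exact: DiffDef.
Qed.

(** The only instance of the chain rule needed for curves: [Ck_on] differentiates
    in fixed directions, and the derivative along the line in direction [v] is
    again a function restricted to that line, so the induction on [k] closes. *)
Lemma Ck_on_line k (U : set V) (S : set R^o) (f : V -> W) (a w : V) : open S ->
  (forall t, S t -> U (a + t *: w)) -> Ck_on k U f ->
  Ck_on k S (fun t : R^o => f (a + t *: w)).
Proof.
move=> oS SU; elim: k f => [|k IH] f /=.
  move=> cf t St.
  apply: (@continuous_comp R^o V W (fun s => a + s *: w) f); last exact: cf (SU _ St).
  by apply: cvgD; [exact: cvg_cst|exact: scalel_continuous].
move=> [df dCk].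
have dl t : S t -> _ := fun St => is_diff_line (df _ (SU t St)).
split => [t /dl []//|v].
apply: Ck_on_congr (IH _ (dCk (v *: w))) => // t /dl [_ ->] //.
Qed.

Lemma derive1_line (f : V -> W) (a w : V) (t : R) :
  differentiable f (a + t *: w) ->
  derive1 (fun s : R => f (a + s *: w)) t = 'd f (a + t *: w) w.
Proof.
by move=> /is_diff_line [dfl dE]; rewrite derive1E' // dE scale1r.
Qed.

End Lines.

(** * Reflection of integrals over the unit interval *)

Section Reflection.
Import HBNNSimple.
Context {R : realType}.
Local Notation mu := (@lebesgue_measure R).
Local Open Scope ereal_scope.

Lemma lebesgue_measure_onem (A : set R) : measurable A ->
  pushforward mu (@onem R : _ -> measurableTypeR R) A = mu A.
Proof.
move=> mA; apply/esym/lebesgue_measure_unique => //=.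
  by apply: continuous_measurable_fun => x; apply: cvgB; [exact: cvg_cst|exact: cvg_id].
move=> mon _ [[a b]] _ <-.
rewrite /pushforward.
have -> : (@onem R @^-1` `]a, b] = `[(1 - b)%R, (1 - a)%R[)%classic.
  by apply/seteqP; split => x /=; rewrite !in_itv /= /onem; lra.
rewrite !lebesgue_measure_itv/= !lte_fin -!EFinB.
by rewrite ltrD2l ltrN2; case: ifP => // _; congr EFin; lra.
Qed.

(** The integral of a nonnegative function is a supremum over the simple functions
    below it, so it is monotone without any measurability. *)
Lemma ge0_le_integralT_nonmeasurable d (T : measurableType d) (nu : {measure set T -> \bar R})
    (f h : T -> \bar R) : (forall x, 0 <= f x) -> (forall x, f x <= h x) ->
  \int[nu]_x f x <= \int[nu]_x h x.
Proof.
move=> f0 fh; have h0 x : 0 <= h x by exact: le_trans (fh x).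
rewrite !ge0_integralTE //; apply: ereal_sup_le => _ [s /= sf <-].
by exists s => //= x; exact: le_trans (fh x).
Qed.

(** Measurability of [f] is avoided by reflecting the simple functions below [f]
    instead of [f] itself; applied twice, the inequality becomes an equality.
    This spares a study of the regularity of the speed of a curve, which is
    defined through a chart varying with the point. *)
Lemma ge0_le_integral_onem (f : R -> \bar R) : (forall x, 0 <= f x) ->
  \int[mu]_x f x <= \int[mu]_x f x.~.
Proof.
move=> f0; rewrite [leLHS]ge0_integralTE //; apply: ge_ereal_sup => _ [s /= sf <-].
have mon : measurable_fun setT (@onem R : measurableTypeR R -> measurableTypeR R).
  by apply: continuous_measurable_fun => x; apply: cvgB; [exact: cvg_cst|exact: cvg_id].
rewrite -integralT_nnsfun.
rewrite (_ : \int[mu]_x (s x)%:E =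
  \int[pushforward mu (@onem R : _ -> measurableTypeR R)]_x (s x)%:E); last first.
  by apply: eq_measure_integral => A mA _; exact/esym/lebesgue_measure_onem.
rewrite ge0_integral_pushforward //=.
- by apply: ge0_le_integralT_nonmeasurable => x //=; rewrite lee_fin.
- exact/measurable_EFinP.
- by move=> x _; rewrite lee_fin.
Qed.

Lemma ge0_integral_onem01 (f : R -> \bar R) : (forall x, 0 <= f x) ->
  \int[mu]_(x in `[0%R, 1%R]) f x.~ = \int[mu]_(x in `[0%R, 1%R]) f x.
Proof.
move=> f0; rewrite [LHS]integral_mkcond [RHS]integral_mkcond.
set G := _ \_ _; set F := f \_ _.
have GF x : G x = F x.~.
  rewrite /G /F /patch !mem_setE !in_itv /= /onem.
  by rewrite (_ : (0 <= 1 - x <= 1)%R = (0 <= x <= 1)%R) //; apply/idP/idP; lra.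
have F0 x : 0 <= F x by exact: erestrict_ge0.
have G0 x : 0 <= G x by rewrite GF.
apply/eqP; rewrite eq_le; apply/andP; split.
  apply: le_trans (ge0_le_integral_onem G0) _.
  by rewrite (_ : (fun x => G x.~) = F) //; apply/funext => x; rewrite GF onemK.
apply: le_trans (ge0_le_integral_onem F0) _.
by rewrite (_ : (fun x => F x.~) = G) //; apply/funext => x; rewrite GF.
Qed.

End Reflection.

(** * Concatenation and reversal of curves *)

Lemma onem_line (R : realType) (t : R) : (1 : R^o) + t *: (-1 : R^o) = t.~.
Proof. by rewrite [t *: _]mulrN1. Qed.

Section Curves.
Context {R : realType} {dim : nat} {M : topologicalType}
  {A : smooth_atlas R dim M} (g : riemannian_metric A).
Implicit Types (phi : chart R dim M) (gamma : R -> M).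

Lemma open_preimage_in (I : set R) gamma (D : set M) : open I ->
  (forall t, I t -> {for t, continuous gamma}) -> open D ->
  open (I `&` gamma @^-1` D).
Proof.
move=> oI cg oD; rewrite openE => t [It Dt].
apply: filterI; first exact: open_nbhs_nbhs.
by apply: (cg t It); exact: open_nbhs_nbhs.
Qed.

Lemma smooth_segment_rev gamma : smooth_segment (A := A) gamma ->
  smooth_segment (A := A) (fun t : R => gamma t.~).
Proof.
move=> [e e0 [cg sg]]; exists e => //.
have flip (t : R) : `]- e, 1 + e[%classic t -> `]- e, 1 + e[%classic t.~.
  by rewrite /= !in_itv /= /onem; lra.
have cr (t : R) : `]- e, 1 + e[%classic t -> {for t, continuous (fun t : R => gamma t.~)}.
  move=> It; apply: (@continuous_comp _ _ _ (@onem R) gamma); last exact: cg (flip _ It).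
  by apply: (@cvgB _ R^o); [exact: cvg_cst|exact: cvg_id].
split => // phi Aphi k.
have -> : coord phi \o (fun t : R => gamma t.~) =
    (fun t : R^o => (coord phi \o gamma) ((1 : R^o) + t *: (-1 : R^o))).
  by apply/funext => t /=; rewrite onem_line.
apply: Ck_on_line (sg _ Aphi k).
  apply: (open_preimage_in _ cr (dom_open phi)); exact: itv_open.
move=> t [It Dt]; rewrite onem_line; split => //; exact: flip.
Qed.

Lemma speed_rev gamma t : smooth_segment (A := A) gamma -> t \in `[0, 1] ->
  speed g (fun t : R => gamma t.~) t = speed g gamma t.~.
Proof.
move=> [e e0 [_ sg]] t01; rewrite /speed /=.
set phi := chart_at A _.
have df : differentiable (coord phi \o gamma : R^o -> _) t.~.
  apply: (sg phi (chart_at_atlas A _) 1%N).1; split.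
    by move: t01; rewrite /= !in_itv /= /onem; lra.
  exact: chart_at_dom.
have -> : velocity phi (fun t : R => gamma t.~) t = - velocity phi gamma t.~.
  rewrite /velocity.
  have -> : coord phi \o (fun t : R => gamma t.~) =
      (fun t : R => (coord phi \o gamma) ((1 : R^o) + t *: (-1 : R^o))).
    by apply/funext => s /=; rewrite onem_line.
  by rewrite derive1_line onem_line // derive1E' // linearN.
by rewrite /inner mulNmx linearN /= mulmxN mulNmx opprK.
Qed.

Lemma curve_length_rev gamma : smooth_segment (A := A) gamma ->
  curve_length g (fun t : R => gamma t.~) = curve_length g gamma.
Proof.
move=> sg; rewrite /curve_length.
rewrite -[RHS]ge0_integral_onem01; last by move=> t; rewrite lee_fin sqrtr_ge0.
by apply: eq_integral => t; rewrite inE => t01; rewrite speed_rev.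
Qed.

Lemma curve_length_ge0 gamma : (0 <= curve_length g gamma)%E.
Proof. by apply: integral_ge0 => t _; rewrite lee_fin sqrtr_ge0. Qed.

Lemma joined_ge0 x y L : joined g x y L -> (0 <= L)%E.
Proof. by elim=> // *; apply: adde_ge0 => //; exact: curve_length_ge0. Qed.

Lemma joined_segment gamma : smooth_segment (A := A) gamma ->
  joined g (gamma 0) (gamma 1) (curve_length g gamma).
Proof.
by move=> sg; rewrite -[curve_length _ _]adde0; apply/joined_cons/joined_refl.
Qed.

Lemma joined_trans x y z L L' :
  joined g x y L -> joined g y z L' -> joined g x z (L + L')%E.
Proof.
move=> xy; elim: {x y L} xy z L' => [x|gamma y L sg _ IH] z L' yz.
  by rewrite add0e.
by rewrite -addeA; apply: joined_cons sg (IH _ _ yz).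
Qed.

Lemma joined_sym x y L : joined g x y L -> joined g y x L.
Proof.
elim=> {x y L} [x|gamma y L sg _ IH]; first exact: joined_refl.
rewrite addeC; apply: joined_trans IH _.
have := joined_segment (smooth_segment_rev sg).
by rewrite curve_length_rev // onem0 onem1.
Qed.

(** * Connection by curves of finite length *)

Section CoordinateSegment.
Variables (phi : chart R dim M) (a w : 'rV[R]_dim).
Hypothesis Aphi : atlas A phi.
(* A neighbourhood of [0, 1] is required, as smooth segments extend beyond their
   end points. *)
Hypothesis line_in : forall t : R, -1 < t < 2 -> (coord phi @` dom phi) (a + t *: w).

Let gamma t := param phi (a + t *: w).

Lemma coordinate_segment_dom (t : R) : -1 < t < 2 ->
  dom phi (gamma t) /\ coord phi (gamma t) = a + t *: w.
Proof.
by move=> /line_in[x dx xE]; rewrite /gamma -xE coordK.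
Qed.

Lemma coordinate_segment_smooth : smooth_segment (A := A) gamma.
Proof.
exists 1 => //.
have I12 (t : R) : `](- 1), (1 + 1)[%classic t -> -1 < t < 2.
  by rewrite /= in_itv /=; lra.
have cg (t : R) : `](- 1), (1 + 1)[%classic t -> {for t, continuous gamma}.
  move=> /I12 /line_in h.
  apply: (@continuous_comp R^o _ _ (fun s => a + s *: w) (param phi)).
    by apply: cvgD; [exact: cvg_cst|exact: scalel_continuous].
  exact: param_continuous.
split => // psi Apsi k.
apply: (@Ck_on_line _ _ _ k _ _ (coord psi \o param phi)) (transition_smooth Aphi Apsi k).
  by apply: (open_preimage_in _ cg (dom_open psi)); exact: itv_open.
move=> t [/I12 /coordinate_segment_dom [d1 cE] d2].
by exists (gamma t).
Qed.

Let energy t := (w *m gram g phi (a + t *: w) *m w^T) 0 0.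

(** The speed at each point is computed in the chart preferred at that point; the
    tensoriality of the metric brings all these computations back to the single
    chart [phi], where the speed is visibly continuous. *)
Lemma coordinate_segment_speed (t : R) : -1 < t < 2 -> speed g gamma t = Num.sqrt (energy t).
Proof.
move=> /coordinate_segment_dom [d1 cE]; rewrite /speed /inner.
set psi := chart_at A _.
have Apsi : atlas A psi by exact: chart_at_atlas.
have d2 : dom psi (gamma t) by exact: chart_at_dom.
have -> : velocity psi gamma t = 'd (coord psi \o param phi) (coord phi (gamma t)) w.
  rewrite cE -derive1_line //.
  by apply: (transition_smooth Aphi Apsi 1%N).1; exists (gamma t).
by rewrite gram_transition // cE.
Qed.

Lemma energy_continuous (t : R) : -1 < t < 2 -> {for t, continuous energy}.
Proof.
move=> ht.
have cG i j : {for t, continuous (fun s : R => gram g phi (a + s *: w) i j)}.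
  apply: (@continuous_comp R^o _ _ (fun s => a + s *: w) (fun y => gram g phi y i j)).
    by apply: cvgD; [exact: cvg_cst|exact: scalel_continuous].
  exact: (gram_smooth g i j Aphi 0%N) (line_in ht).
rewrite /energy.
rewrite (_ : (fun s => _) =
  fun s => \sum_j (\sum_i w 0 i * gram g phi (a + s *: w) i j) * w 0 j); last first.
  apply/funext => s; rewrite mxE; apply: eq_bigr => j _.
  by rewrite [in RHS]mulrC mxE mulrC mxE.
apply: cvg_big => [|j _]; first exact: add_continuous.
apply: cvgM; last exact: cvg_cst.
apply: cvg_big => [|i _]; first exact: add_continuous.
by apply: cvgM; [exact: cvg_cst|exact: cG].
Qed.

Lemma coordinate_segment_length : (curve_length g gamma < +oo)%E.
Proof.
have -> : curve_length g gamma =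
    (\int[lebesgue_measure]_(t in `[0%R, 1%R]) (Num.sqrt (energy t))%:E)%E.
  apply: eq_integral => t; rewrite inE /= in_itv /= => t01.
  by rewrite coordinate_segment_speed //; move: t01; lra.
suff /integrable_fin_num : lebesgue_measure.-integrable `[0%R, 1%R]
    (EFin \o (Num.sqrt \o energy)) by rewrite ltey_eq => ->.
apply: continuous_compact_integrable; first exact: segment_compact.
apply: continuous_in_subspaceT => t; rewrite inE /= in_itv /= => t01.
apply: continuous_comp; last exact: sqrt_continuous.
by apply: energy_continuous; move: t01; lra.
Qed.

End CoordinateSegment.

Definition rectifiably_joined (x y : M) := exists2 L, joined g x y L & (L < +oo)%E.

Lemma rectifiably_joined_sym x y :
  rectifiably_joined x y -> rectifiably_joined y x.
Proof. by move=> [L /joined_sym]; exists L. Qed.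

Lemma rectifiably_joined_trans x y z : rectifiably_joined x y ->
  rectifiably_joined y z -> rectifiably_joined x z.
Proof.
move=> [L xy Loo] [L' yz Loo']; exists (L + L')%E; last exact: lte_add_pinfty.
exact: joined_trans yz.
Qed.

(** Coordinate balls are star-shaped about their centre. *)
Lemma near_rectifiably_joined p : \forall q \near p, rectifiably_joined p q.
Proof.
pose phi := chart_at A p; pose a := coord phi p.
have Aphi : atlas A phi by exact: chart_at_atlas.
have dp : dom phi p by exact: chart_at_dom.
have : nbhs a (coord phi @` dom phi).
  by apply: open_nbhs_nbhs; split; [exact: image_open|exists p].
rewrite -nbhs_ballE => -[r /= r0 ball_in].
have near_dom : \forall q \near p, dom phi q by exact: open_nbhs_nbhs (conj (dom_open phi) dp).
(* Half the radius, since the segment is followed up to parameter 2. *)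
have near_ball : \forall q \near p, ball a (r / 2) (coord phi q).
  by apply: (coord_continuous dp); apply: nbhsx_ballx; rewrite divr_gt0.
near=> q.
pose w := coord phi q - a.
have wr : `|w| < r / 2.
  have : ball a (r / 2) (coord phi q) by near: q.
  by rewrite -ball_normE /= distrC.
have line_in (t : R) : -1 < t < 2 -> (coord phi @` dom phi) (a + t *: w).
  move=> ht; apply: ball_in; rewrite -ball_normE /= opprD addNKr normrN normrZ.
  have t2 : `|t| <= 2 by rewrite ler_norml; lra.
  apply: le_lt_trans (ler_wpM2r (normr_ge0 w) t2) _.
  by rewrite -ltr_pdivlMl // mulrC.
have dq : dom phi q by near: q.
have := joined_segment (coordinate_segment_smooth Aphi line_in).
rewrite scale0r addr0 scale1r /w addrC subrK !coordK // => J.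
exists (curve_length g (fun t => param phi (a + t *: w))) => //.
exact: coordinate_segment_length.
Unshelve. all: by end_near. Qed.

Hypothesis connM : connected [set: M].

(** The points reachable from [x] form an open set by the local statement, and so
    do the points that are not reachable. *)
Lemma connected_rectifiably_joined x y : rectifiably_joined x y.
Proof.
have refl : rectifiably_joined x x by exists 0%E => //; exact: joined_refl.
suff : [set y | rectifiably_joined x y] = setT by move=> /seteqP[_ /(_ y Logic.I)].
apply: connM; first by exists x.
- exists [set y | rectifiably_joined x y]; rewrite ?setTI // openE => z /= xz.
  apply: filterS (near_rectifiably_joined z) => q; exact: rectifiably_joined_trans.
- exists [set y | rectifiably_joined x y]; rewrite ?setTI // -openC openE => z /= xz.
  apply: filterS (near_rectifiably_joined z) => q zq xq; apply: xz.
  exact: rectifiably_joined_trans xq (rectifiably_joined_sym zq).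
Qed.

(** * The Riemannian distance is a pseudometric *)

(** Without finiteness of the infimum, [fine] would collapse an infinite distance
    to 0 and break the triangle inequality. *)
Lemma EFin_rdist x y : (rdist g x y)%:E = ereal_inf [set L | joined g x y L].
Proof.
rewrite /rdist fineK // ge0_fin_numE; last first.
  by apply: le_ereal_inf_tmp => L /= /joined_ge0.
have [L xy] := connected_rectifiably_joined x y.
by apply: le_lt_trans; apply: ereal_inf_lbound.
Qed.

Lemma rdist_ge0 x y : 0 <= rdist g x y.
Proof.
by rewrite -lee_fin EFin_rdist; apply: le_ereal_inf_tmp => L /= /joined_ge0.
Qed.

Lemma rdist_sym x y : rdist g x y = rdist g y x.
Proof.
by rewrite /rdist; congr (fine (ereal_inf _)); apply/seteqP; split=> L /joined_sym.
Qed.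

Lemma rdist_triangle x y z : rdist g x z <= rdist g x y + rdist g y z.
Proof.
rewrite -lee_fin; apply/lee_addgt0Pr => e e0; have e20 : 0 < e / 2 by rewrite divr_gt0.
have near_inf u v : exists2 L, joined g u v L & (L < (rdist g u v + e / 2)%:E)%E.
  rewrite EFinD EFin_rdist; apply: lb_ereal_inf_adherent => //.
  by rewrite -EFin_rdist.
have [L xy Lxy] := near_inf x y; have [L' yz Lyz] := near_inf y z.
apply: (@le_trans _ _ (L + L')%E).
  by rewrite EFin_rdist; apply: ereal_inf_lbound; exact: joined_trans yz.
rewrite -EFinD (_ : _ + e = (rdist g x y + e / 2) + (rdist g y z + e / 2)); last by lra.
by rewrite EFinD; apply/ltW/lteD.
Qed.

End Curves.

(** * The Huber loss *)

Section HuberLoss.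
Context {R : realType} (c : R).
Hypothesis c_ge0 : 0 <= c.

(** The slope at infinity, which is also the Lipschitz constant; the case [c = 0]
    differs because the loss is then the distance itself rather than the limit of
    the Huber losses, which vanishes. *)
Definition huber_slope : R := if c == 0 then 1 else 2 * c.

Lemma huber_slope_gt0 : 0 < huber_slope.
Proof. by rewrite /huber_slope; case: eqP => // /eqP c0; rewrite mulr_gt0 // lt0r c0. Qed.

(** One-sided, hence combining monotonicity with the Lipschitz bound: this is the
    form in which the triangle inequality is used. *)
Lemma huber_loss_lipschitz x y d : 0 <= x -> 0 <= y -> 0 <= d -> y <= x + d ->
  huber_loss c y <= huber_loss c x + huber_slope * d.
Proof.
move=> x0 y0 d0 yxd; rewrite /huber_loss /huber_slope.
case: eqP => [_|/eqP c0]; first by rewrite mul1r.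
have cp : 0 < c by rewrite lt0r c0.
have cc : 2 * c * (c / 2) = c ^+ 2 by field.
rewrite !mulrBr cc; have cd := mulr_ge0 c_ge0 d0.
case: (lerP y c) => yc; case: (lerP x c) => xc.
- case: (lerP y x) => yx.
  + suff : y ^+ 2 <= x ^+ 2 by lra.
    by rewrite ler_sqr.
  + have : (y - x) * (y + x) <= d * (2 * c) by apply: ler_pM; lra.
    by rewrite !expr2; lra.
- have : y ^+ 2 <= c ^+ 2 by rewrite ler_sqr // nnegrE.
  have : c * c <= c * x by rewrite ler_pM2l // ltW.
  by rewrite !expr2; lra.
- have : c * y <= c * (x + d) by rewrite ler_pM2l.
  by have := sqr_ge0 (x - c); rewrite !expr2; lra.
- have : c * y <= c * (x + d) by rewrite ler_pM2l.
  by lra.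
Qed.

(** On the quadratic branch this is [0 <= (x - c) ^+ 2]; the linear branch is an
    equality. *)
Lemma huber_loss_ge_linear x : huber_slope * x - c ^+ 2 <= huber_loss c x.
Proof.
rewrite /huber_loss /huber_slope; case: eqP => [->|/eqP c0]; first by rewrite expr0n mul1r subr0.
case: ifP => xc; first by have := sqr_ge0 (x - c); rewrite !expr2; lra.
by rewrite mulrBr (_ : 2 * c * (c / 2) = c ^+ 2) //; field.
Qed.

Lemma huber_loss_ge0 x : 0 <= x -> 0 <= huber_loss c x.
Proof.
move=> x0; rewrite /huber_loss; case: eqP => // _; case: (lerP x c) => xc.
  exact: sqr_ge0.
apply: mulr_ge0; first by rewrite mulr_ge0.
by rewrite subr_ge0; move: c_ge0 xc; lra.
Qed.

End HuberLoss.

Lemma sum_signed_card (R : realType) n (S : {set 'I_n}) (a : R) :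
  \sum_(i < n) (if i \in S then - a else a) = (n%:R - #|S|%:R *+ 2) * a.
Proof.
have -> : \sum_(i < n) (if i \in S then - a else a) =
    \sum_(i < n) (a - (if i \in S then a *+ 2 else 0)).
  by apply: eq_bigr => i _; case: ifP => _; rewrite ?subr0 // mulr2n opprD addNKr.
rewrite sumrB sumr_const card_ord -big_mkcond sumr_const.
by rewrite mulrBl mulrnAl !mulr_natl mulrnAC.
Qed.

(** * The breakdown point *)

Section Breakdown.
Context {R : realType} {dim : nat} {M : topologicalType}
  {A : smooth_atlas R dim M} (g : riemannian_metric A).
Hypothesis connM : connected [set: M].
Context {n : nat} (c : R).
Hypothesis c_ge0 : 0 <= c.
Implicit Types X Y : 'I_n -> M.

(** What an uncorrupted observation may fail to contribute, in the comparison of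
    the risks at [mY] and [m], to the full amount: slope times distance from [m]
    to [mY]. It does not involve [mY]. *)
Definition huber_offset X (m : M) (i : 'I_n) : R :=
  huber_slope c * rdist g (X i) m + c ^+ 2 + huber_loss c (rdist g (X i) m).

(** With [s] the slope and [a] the distance from [m] to [mY], moving from [m] to
    [mY] lowers the loss of each of the [k] corrupted observations by at most
    [s * a] and raises that of each other one by at least [s * a] minus its
    offset. As [mY] is a minimizer, the total change is at most 0, so that
    [(n - 2 * k) * s * a] is at most the sum of the offsets. *)
Lemma corrupted_mean_bound X Y m mY k : (k.*2 < n)%N -> corruption k X Y ->
  minimizes_huber_risk g c Y mY ->
  rdist g m mY <= (\sum_i huber_offset X m i) / huber_slope c.
Proof.
move=> kn [S cardS YX] /(_ m) minY.
have n_gt0 : 0 < n%:R :> R by rewrite ltr0n; lia.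
move: minY; rewrite /huber_risk ler_pM2l ?invr_gt0 // => minY.
set a := rdist g m mY; set s := huber_slope c.
have s0 : 0 < s := huber_slope_gt0 c_ge0.
have a0 : 0 <= a := rdist_ge0 g connM _ _.
have term i : (if i \in S then - (s * a) else s * a) <= huber_offset X m i +
    (huber_loss c (rdist g (Y i) mY) - huber_loss c (rdist g (Y i) m)).
  have d0 p q := rdist_ge0 g connM p q.
  case: ifP => [iS|/negbT /YX ->].
    have o0 : 0 <= huber_offset X m i.
      rewrite /huber_offset -/s !addr_ge0 ?sqr_ge0 ?huber_loss_ge0 //.
      by rewrite mulr_ge0 // ltW.
    suff : huber_loss c (rdist g (Y i) m) <= huber_loss c (rdist g (Y i) mY) + s * a.
      by lra.
    apply: huber_loss_lipschitz => //.
    by rewrite [a](rdist_sym g); exact: rdist_triangle.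
  have := huber_loss_ge_linear c (rdist g (X i) mY); rewrite -/s.
  have : s * a <= s * (rdist g (X i) m + rdist g (X i) mY).
    by rewrite ler_pM2l // (rdist_sym g (X i) m); exact: rdist_triangle.
  by rewrite /huber_offset -/s; lra.
have := ler_sum (index_enum 'I_n) (fun i (_ : true) => term i).
rewrite sum_signed_card big_split /= sumrB cardS => total.
have gap : 1 <= n%:R - k%:R *+ 2 :> R.
  by rewrite -mulrnA muln2 lerBrDr -[1]/(1%:R) -natrD ler_nat; lia.
rewrite ler_pdivlMr // mulrC.
have : s * a <= (n%:R - k%:R *+ 2) * (s * a).
  by rewrite ler_peMl // mulr_ge0 // ltW.
by lra.
Qed.

End Breakdown.

Theorem theorem6 (R : realType) (dim : nat) (M : topologicalType)
    (A : smooth_atlas R dim M) (g : riemannian_metric A)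
    (hausM : hausdorff_space M) (connM : connected [set: M])
    (sepM : separable M) (complM : geodesically_complete g)
    (Delta_fin : (ereal_sup (sectional_curvatures g) < +oo)%E)
    (delta_fin : (-oo < ereal_inf (sectional_curvatures g))%E)
    (n : nat) (n_gt0 : (0 < n)%N) (X : 'I_n -> M)
    (c : R) (c_ge0 : 0 <= c)
    (X_mean : exists m, is_huber_mean g c X m) :
  ((n.+1 %/ 2)%N)%:R / n%:R <= breakdown_point g c X.
Proof.
have nR : 0 < n%:R :> R by rewrite ltr0n.
have [m [_ m_unique]] := X_mean.
rewrite /breakdown_point.
apply: (big_ind (fun x => (n.+1 %/ 2)%:R / n%:R <= x)) => [|x y hx hy|k /asboolP broken].
- by rewrite ler_pdivrMr // mul1r ler_nat; lia.
- by rewrite le_min hx.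
rewrite ler_pM2r ?invr_gt0 // ler_nat leqNgt; apply/negP => k_small.
suff : (ereal_sup [set r : \bar R | exists m Y mY,
    [/\ is_huber_mean g c X m, corruption k X Y, is_huber_mean g c Y mY &
        r = (rdist g m mY)%:E]] <=
    ((\sum_i huber_offset g c X m i) / huber_slope c)%:E)%E.
  by move: broken; rewrite /breaks_down => ->; rewrite leye_eq.
apply: ge_ereal_sup => _ [m' [Y [mY [[m'_min _] XY [mY_min _] ->]]]].
rewrite lee_fin (m_unique _ m'_min).
by apply: (corrupted_mean_bound connM c_ge0) XY mY_min; lia.
Qed.
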